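(* Let $d\ge 1$ be an integer. For every finite (nonempty, simple) $d$-regular graph $G$ and every real $\lambda>0$, \[ \alpha^M_G(\lambda)\le\alpha^M_{K_{d,d}}(\lambda), \] where $\alpha^M_G(\lambda)$ is the edge occupancy fraction of the monomer-dimer model on $G$ at fugacity $\lambda$. Moreover, the maximum is achieved only by disjoint unions of copies of $K_{d,d}$: if for some $\lambda>0$ equality holds, then $G$ is a disjoint union of copies of $K_{d,d}$.
   Context: For a finite graph $G$, let $\mathcal M$ be the set of all matchings of $G$ (including the empty matching), where $|H|$ is the number of edges of a matching $H$, and let $M_G(\lambda)=\sum_{H\in\mathcal M}\lambda^{|H|}$ be the matching polynomial. The monomer-dimer model with fugacity $\lambda$ on $G$ is the random matching $H$ with $\Pr[H]=\lambda^{|H|}/M_G(\lambda)$. The edge occupancy fraction is the expected fraction of edges of $G$ in $H$: \[ \alpha^M_G(\lambda)=\frac{1}{|E(G)|}\sum_{e\in E(G)}\Pr[e\in H]=\frac{1}{|E(G)|}\frac{\lambda M_G'(\lambda)}{M_G(\lambda)}. \] $K_{d,d}$ denotes the complete bipartite graph with $d$ vertices in each part. *)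

(* Defs.v *)
From mathcomp Require Import all_boot all_order all_algebra.
From mathcomp Require Import reals.

Set Implicit Arguments.
Unset Strict Implicit.
Unset Printing Implicit Defensive.

Import Order.TTheory GRing.Theory Num.Theory.
Local Open Scope ring_scope.

Record sgraph := SGraph {
  vertex :> finType;
  adj : rel vertex;
  adj_sym : symmetric adj;
  adj_irr : irreflexive adj }.

Definition edges (G : sgraph) : {set {set G}} :=
  [set [set p.1; p.2] | p : G * G & adj p.1 p.2].

Definition regular (G : sgraph) (d : nat) : Prop :=
  forall x : G, #|[set y | adj x y]| = d.

(* Edges are nonempty sets, so [trivIset H] says exactly that any two distinct
   edges of [H] have no common endpoint. *)
Definition matchings (G : sgraph) : {set {set {set G}}} :=
  [set H : {set {set G}} | (H \subset edges G) && trivIset H].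

Definition matching_poly (R : nzRingType) (G : sgraph) : {poly R} :=
  \sum_(H in matchings G) 'X^#|H|.

Definition matching_prob (R : realType) (G : sgraph) (lambda : R)
    (H : {set {set G}}) : R :=
  lambda ^+ #|H| / (matching_poly R G).[lambda].

Definition edge_prob (R : realType) (G : sgraph) (lambda : R) (e : {set G}) : R :=
  \sum_(H in matchings G | e \in H) matching_prob lambda H.

Definition edge_occupancy (R : realType) (G : sgraph) (lambda : R) : R :=
  #|edges G|%:R^-1 * \sum_(e in edges G) edge_prob lambda e.

Lemma edge_occupancy_deriv (R : realType) (G : sgraph) (lambda : R) :
  edge_occupancy G lambda =
  #|edges G|%:R^-1 *
  (lambda * (matching_poly R G)^`().[lambda] / (matching_poly R G).[lambda]).
Proof.
rewrite /edge_occupancy /edge_prob /matching_prob; congr (_ * _).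
set M := (matching_poly R G).[lambda].
rewrite (exchange_big_dep (mem (matchings G))) => [|e H _ /andP[]//] /=.
rewrite /matching_poly raddf_sum horner_sum mulr_sumr mulr_suml.
apply: eq_bigr => H; rewrite inE => /andP[/subsetP sHE tH].
rewrite (eq_bigl (mem H)) => [|e]; last first.
  rewrite inE /= (_ : H \subset edges G) ?tH /=; last exact/subsetP.
  by apply/andP/idP => [[]//|eH]; split=> //; exact: sHE.
rewrite sumr_const /= derivXn hornerMn hornerXn mulrnAr mulrnAl.
by case: #|H| => [|n]; rewrite ?mulr0n /= ?exprS.
Qed.

Definition bip_adj (d : nat) : rel ('I_d + 'I_d) :=
  fun u v => match u, v with
  | inl _, inr _ | inr _, inl _ => true
  | _, _ => false
  end.

Lemma bip_adj_sym d : symmetric (@bip_adj d).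
Proof. by case=> ? [?|?]. Qed.

Lemma bip_adj_irr d : irreflexive (@bip_adj d).
Proof. by case. Qed.

Definition complete_bip (d : nat) : sgraph :=
  SGraph (@bip_adj_sym d) (@bip_adj_irr d).

Definition copies_adj (n : nat) (G : sgraph) : rel ('I_n * G) :=
  fun u v => (u.1 == v.1) && adj u.2 v.2.

Lemma copies_adj_sym n G : symmetric (@copies_adj n G).
Proof. by move=> u v; rewrite /copies_adj eq_sym adj_sym. Qed.

Lemma copies_adj_irr n G : irreflexive (@copies_adj n G).
Proof. by move=> u; rewrite /copies_adj adj_irr andbF. Qed.

Definition disjoint_copies (n : nat) (G : sgraph) : sgraph :=
  SGraph (@copies_adj_sym n G) (@copies_adj_irr n G).

Definition isomorphic (G G' : sgraph) : Prop :=
  exists2 f : G -> G', bijective f & forall x y, adj (f x) (f y) = adj x y.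

(* Main.v *)
Require Import Defs.
From mathcomp Require Import all_boot all_order all_algebra.
From mathcomp Require Import reals.
From mathcomp Require Import ring lra zify.

(** For a matching [H] let a monomer be an uncovered vertex, and let [t(v)] be
    the number of monomers adjacent to [v]. Inserting an edge at [u] expresses
    the configurations "[v] is a monomer with a covered neighbour [u]" through
    those in which [u] and [v] are adjacent monomers, and gives, for any [f],
    an identity
      E [ sum over monomers v of
            lambda t(v) (t(v) - 1) f(t(v) - 1) - (d - t(v)) f(t(v)) ]
        = lambda E [ sum over adjacent monomers v, u of defect(v, u) ],
      defect(v, u) = (t(v) - t(u)) (f(t(v) - 1) - f(t(u) - 1)) / 2
        + sum over monomers x adjacent to both of f(t(v) - 1) - f(t(v) - 2).
    If [f] is increasing the defect is nonnegative, and in [K_{d,d}] it vanishes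
    because [t(v) = t(u)] and there are no triangles. Choosing [f] as the
    solution of a Poisson equation for a birth-death chain, the left-hand
    summand becomes [mu - t(v)], whose expectation is a positive multiple of
    the difference of the two occupancy fractions. A maximum principle shows
    that [f] is strictly increasing. In case of equality all defects vanish;
    for the empty matching and the one-edge matchings this says that [G] has no
    triangle and that any two neighbours of a vertex have the same
    neighbourhood, so that every component is [K_{d,d}]. *)

Set Implicit Arguments.
Unset Strict Implicit.
Unset Printing Implicit Defensive.

Import Order.TTheory GRing.Theory Num.Theory.
Local Open Scope ring_scope.

(** * Poisson equation: positivity and monotonicity of the solution *)

Lemma natr_falling2_ge0 (R : numDomainType) (t : nat) :
  0 <= t%:R * (t%:R - 1) :> R.
Proof. by case: t => [|t]; rewrite ?mul0r // -natr1 addrK mulr_ge0 ?addr_ge0. Qed.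

(** Below [mu] the equation is read forwards from [t = 0], the source [mu - t] being positive. Above
    [mu] it is read backwards from [t = d], where the coefficient of [h d] vanishes. *)
Lemma poisson_pos (R : realFieldType) (d : nat) (lambda mu : R) (h : nat -> R) :
    0 < lambda -> 0 < mu < d%:R ->
    (forall t, (t <= d)%N -> (d%:R - t%:R) * h t =
       mu - t%:R + lambda * (t%:R * (t%:R - 1)) * h t.-1) ->
  forall t, (0 < t < d)%N -> 0 < h t.
Proof.
move=> l0 /andP[mu0 mud] hE.
have low t : t%:R < mu -> 0 < h t.
  have dt s : s%:R < mu -> 0 < d%:R - s%:R :> R by move=> ?; lra.
  elim: t => [|t IHt] tmu.
    have := hE 0%N (leq0n _).
    rewrite mul0r mulr0 mul0r !subr0 addr0 => e.
    by rewrite -(pmulr_rgt0 _ (dt _ tmu)) subr0 e.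
  have td : (t.+1 <= d)%N by rewrite -(ler_nat R); lra.
  rewrite -(pmulr_rgt0 _ (dt _ tmu)) (hE _ td) /= ltr_pwDl ?subr_gt0 //.
  have /IHt ht : t%:R < mu by apply: lt_trans tmu; rewrite ltr_nat.
  by rewrite mulr_ge0 ?(ltW ht) // mulr_ge0 ?(ltW l0) ?natr_falling2_ge0.
have high k t : (t + k = d)%N -> (1 < t)%N -> mu < t%:R -> 0 < h t.-1.
  have c0 s : (1 < s)%N -> 0 < lambda * (s%:R * (s%:R - 1)).
    by move=> s1; rewrite !mulr_gt0 ?subr_gt0 ?ltr1n ?ltr0n // ltnW.
  elim: k t => [|k IHk] t tk t1 mut; rewrite -(pmulr_rgt0 _ (c0 t t1)).
    have := hE t; rewrite -tk addn0 leqnn subrr mul0r => /(_ isT) e; lra.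
  have td : (t <= d)%N by rewrite -tk leq_addr.
  have ht : 0 < h t.
    apply: (IHk t.+1); [by rewrite addSnnS | exact: ltnW | ].
    by apply: lt_trans mut _; rewrite ltr_nat.
  have : 0 <= (d%:R - t%:R) * h t.
    by rewrite mulr_ge0 ?(ltW ht) // subr_ge0 ler_nat.
  by rewrite hE //; lra.
move=> t /andP[t0 td].
have [/low//|mut] := ltP t%:R mu.
apply: (high (d - t.+1)%N t.+1); rewrite ?subnKC //.
by apply: le_lt_trans mut _; rewrite ltr_nat.
Qed.

(* Discrete maximum principle for the differences of [h]. *)
Lemma poisson_decreasing (R : realFieldType) (d : nat) (lambda mu : R)
    (h : nat -> R) :
    0 < lambda -> 0 < mu < d%:R ->
    (forall t, (t <= d)%N -> (d%:R - t%:R) * h t =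
       mu - t%:R + lambda * (t%:R * (t%:R - 1)) * h t.-1) ->
  forall t, (t.+1 < d)%N -> h t.+1 < h t.
Proof.
move=> l0 mud hE.
have h_gt0 := poisson_pos l0 mud hE.
(* [r] is the source term that remains when consecutive equations are subtracted and rewritten for
   the increments of [h]. *)
pose r t := (1 + 2 * lambda * t%:R) * h t - 1.
have diffE t : (t < d)%N -> (d%:R - t.+1%:R) * (h t.+1 - h t) =
    lambda * (t%:R * (t%:R - 1)) * (h t - h t.-1) + r t.
  move=> td; have := hE t (ltnW td); have := hE t.+1 td.
  by rewrite /r /= -(@natr1 _ t) => e1 e2; lra.
have lt0 t : 0 <= lambda * (t%:R * (t%:R - 1)).
  by rewrite mulr_ge0 ?(ltW l0) ?natr_falling2_ge0.
have r_gt0 t : (t.+1 < d)%N -> 0 <= r t -> h t <= h t.+1 -> 0 < r t.+1.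
  move=> td rt ht; have ht1 := h_gt0 t.+1 td.
  have : 0 <= (1 + 2 * lambda * t%:R) * (h t.+1 - h t).
    by rewrite mulr_ge0 ?subr_ge0 // addr_ge0 // !mulr_ge0 // ltW.
  have : 0 < lambda * h t.+1 by rewrite mulr_gt0.
  by move: rt; rewrite /r -(@natr1 _ t); lra.
(* A weak ascent with [0 <= r t] forces another at [t.+1], and so on, until [diffE] at [d.-1]
   equates zero with a positive number. *)
have no_ascent k t : (t + k.+2 = d)%N -> 0 <= r t -> h t <= h t.+1 -> False.
  elim: k t => [|k IHk] t tk rt ht.
    have td : (t.+1 < d)%N by lia.
    have := r_gt0 t td rt ht; have /= := diffE t.+1 td.
    have : 0 <= lambda * (t.+1%:R * (t.+1%:R - 1)) * (h t.+1 - h t).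
      by rewrite mulr_ge0 ?subr_ge0.
    have -> : d = t.+2 by lia.
    by rewrite subrr mul0r; lra.
  have td : (t.+1 < d)%N by lia.
  have rt1 := r_gt0 t td rt ht; have /= e := diffE t.+1 td.
  have q : 0 <= lambda * (t.+1%:R * (t.+1%:R - 1)) * (h t.+1 - h t).
    by rewrite mulr_ge0 ?subr_ge0.
  have p : 0 < d%:R - t.+2%:R :> R by rewrite subr_gt0 ltr_nat; lia.
  apply: (IHk t.+1); first by rewrite addSnnS.
    exact: ltW.
  have : 0 < (d%:R - t.+2%:R) * (h t.+2 - h t.+1) by lra.
  by rewrite pmulr_rgt0 // subr_gt0 => /ltW.
(* At a first ascent [r] is nonnegative: for [t = 0] it is the whole right side of [diffE]; later
   the preceding descent makes the other term nonpositive. *)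
elim=> [|t IHt] td; rewrite ltNge; apply/negP => ht.
  have := diffE _ (ltnW td); rewrite mul0r mulr0 mul0r add0r => e.
  apply: (no_ascent (d - 2)%N 0%N) => //; first lia.
  by rewrite -e mulr_ge0 // subr_ge0 // ler_nat ltnW.
have e := diffE _ (ltnW td); have {IHt} ht' := IHt (ltnW td).
apply: (no_ascent (d - t.+3)%N t.+1) => //; first lia.
have : 0 <= (d%:R - t.+2%:R) * (h t.+2 - h t.+1).
  by rewrite mulr_ge0 // subr_ge0 // ler_nat ltnW.
have : 0 <= lambda * (t.+1%:R * (t.+1%:R - 1)) * (h t - h t.+1).
  by rewrite mulr_ge0 // subr_ge0 ltW.
by move: e => /=; lra.
Qed.

(** * Matchings and the insertion of an edge *)

Lemma set2_edges (G : sgraph) (u v : G) : ([set u; v] \in edges G) = adj u v.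
Proof.
apply/imsetP/idP => [[[a b]]|uv]; last by exists (u, v); rewrite ?inE.
rewrite inE /= => ab eab; move: ab.
have: b \in [set u; v] by rewrite eab set22.
have: a \in [set u; v] by rewrite eab set21.
rewrite !inE => /orP[]/eqP-> /orP[]/eqP-> //; rewrite ?adj_irr //.
by rewrite adj_sym.
Qed.

Lemma edgesP (G : sgraph) (e : {set G}) :
  reflect (exists u v, adj u v /\ e = [set u; v]) (e \in edges G).
Proof.
apply: (iffP imsetP) => [[[u v]]|[u [v [uv ->]]]].
  by rewrite inE => uv ->; exists u, v.
by exists (u, v); rewrite ?inE.
Qed.

Lemma set0_edges (G : sgraph) : set0 \notin edges G.
Proof.
apply/edgesP => -[u [v [_ /setP/(_ u)]]].
by rewrite !inE eqxx.
Qed.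

Definition monomer (G : sgraph) (H : {set {set G}}) (v : G) := v \notin cover H.

Definition monomer_deg (G : sgraph) (H : {set {set G}}) (v : G) : nat :=
  #|[set u | adj v u && monomer H u]|.

Lemma monomer_setU1 (G : sgraph) (H : {set {set G}}) (u x v : G) :
  monomer ([set u; x] |: H) v = [&& v != u, v != x & monomer H v].
Proof.
by rewrite /monomer /cover bigcup_setU big_set1 !inE !negb_or -andbA.
Qed.

(** The left side has the shape of the side condition left by [reindex_onto] when an edge is added;
    its second conjunct says that the edge was not yet in [H]. *)
Lemma add_edge_matching (G : sgraph) (H : {set {set G}}) (u v : G) :
  ([set u; v] |: H \in matchings G) && (([set u; v] |: H) :\ [set u; v] == H)
  = [&& H \in matchings G, monomer H u, monomer H v & adj u v].
Proof.
set e := [set u; v].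
apply/andP/and4P => [[] | [mH mu mv uv]].
  rewrite !inE => /andP[sub triv] /eqP eH.
  have eNH : e \notin H by rewrite -eH !inE eqxx.
  have HeH : H \subset e |: H by exact: subsetUr.
  have out z : z \in e -> monomer H z.
    move=> ze; apply/bigcupP => -[B BH zB].
    have neB : e != B by apply: contraNneq eNH => ->.
    have BeH : B \in e |: H by rewrite inE BH orbT.
    have := trivIsetP triv e B (setU11 _ _) BeH neB.
    by move=> /disjointFr/(_ ze); rewrite zB.
  split; last first.
  - by rewrite -set2_edges (subsetP sub) ?setU11.
  - by apply: out; rewrite set22.
  - by apply: out; rewrite set21.
  - by rewrite (subset_trans HeH sub) (trivIsetS HeH triv).
move: mH; rewrite inE => /andP[sub triv].
have dis : {in H, forall B : {set G}, [disjoint e & B]}.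
  move=> B BH; rewrite disjoint_sym disjoints_subset; apply/subsetP => z zB.
  rewrite !inE negb_or; apply/andP; split; [move: mu | move: mv];
    by apply: contraNneq => <-; apply/bigcupP; exists B.
have z0 : set0 \notin H.
  by apply: contra (set0_edges G) => /(subsetP sub).
have [triv' eNH] := trivIsetU1 dis triv z0.
rewrite setU1K // eqxx inE triv' andbT subUset sub1set set2_edges uv sub.
by [].
Qed.

(** If [uv] is an edge, adding it is a bijection from the matchings that miss both ends to those
    that contain it; the extra factor [lambda] is its weight. *)
Lemma sum_matchings_edge (R : comPzSemiRingType) (G : sgraph) (lambda : R) (u v : G)
    (F : {set {set G}} -> R) :
  \sum_(H in matchings G) ([set u; v] \in H)%:R * (lambda ^+ #|H| * F H) =
  \sum_(H in matchings G) [&& monomer H u, monomer H v & adj u v]%:R *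
     (lambda ^+ #|H| * (lambda * F ([set u; v] |: H))).
Proof.
set e := [set u; v].
transitivity (\sum_(H in matchings G | e \in H) lambda ^+ #|H| * F H).
  by rewrite big_mkcondr; apply: eq_bigr => H _;
    case: (e \in H); rewrite ?mul1r ?mul0r.
rewrite (reindex_onto (fun H => e |: H) (fun H => H :\ e)); last first.
  by move=> H /andP[_ eH]; rewrite setD1K.
transitivity (\sum_(H in matchings G | [&& monomer H u, monomer H v & adj u v])
   lambda ^+ #|H| * (lambda * F (e |: H))).
  rewrite (eq_bigl (fun H =>
    [&& H \in matchings G, monomer H u, monomer H v & adj u v])).
    apply: eq_bigr => H /and4P[_ mu _ _]; rewrite cardsU1.
    have -> : e \notin H.
      apply: contra mu => eH; apply/bigcupP; exists e => //; exact: set21.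
    by rewrite exprS mulrCA !mulrA.
  by move=> H; rewrite setU11 andbT add_edge_matching.
rewrite big_mkcondr; apply: eq_bigr => H _.
by case: ([&& _, _ & _]); rewrite ?mul1r ?mul0r.
Qed.

Lemma card_partner (G : sgraph) (H : {set {set G}}) (u : G) :
  H \in matchings G -> #|[set v | [set u; v] \in H]| = ~~ monomer H u :> nat.
Proof.
rewrite inE => /andP[sub triv]; rewrite negbK.
have [/bigcupP[e eH ue]|uN] := boolP (u \in cover H); last first.
  apply: eq_card0 => v; rewrite inE; apply: contraNF uN => uvH.
  by apply/bigcupP; exists [set u; v]; rewrite ?set21.
have /edgesP[a [b [ab eab]]] := subsetP sub e eH.
have [v ev] : exists v, e = [set u; v].
  move: ue; rewrite eab !inE => /orP[]/eqP->; first by exists b.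
  by exists a; rewrite setUC.
apply/eqP/cards1P; exists v; apply/setP => x; rewrite !inE.
apply/idP/eqP => [uxH|->]; last by rewrite -ev.
have [exu|] := eqVneq [set u; x] e; last first.
  move=> /(trivIsetP triv _ _ uxH eH)/disjointFr/(_ (set21 u x)).
  by rewrite ue.
have := subsetP sub _ uxH; rewrite set2_edges.
have: x \in e by rewrite -exu set22.
by rewrite ev !inE => /orP[]/eqP-> //; rewrite adj_irr.
Qed.

(** Each edge is counted once per orientation. Arbitrary edge sets are allowed because
    [edge_occupancyE] applies this to all of [edges G]. *)
Lemma card_ordered_edges (G : sgraph) (H : {set {set G}}) :
  H \subset edges G -> (\sum_u #|[set v | [set u; v] \in H]| = 2 * #|H|)%N.
Proof.
move=> sub.
transitivity (\sum_u \sum_(v | [set u; v] \in H) 1)%N.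
  by apply: eq_bigr => u _; rewrite sum1dep_card.
rewrite pair_big_dep /= mulnC -sum_nat_const.
rewrite (partition_big (fun p : G * G => [set p.1; p.2]) (mem H)) //=.
apply: eq_bigr => e eH; have /edgesP[a [b [ab eab]]] := subsetP sub e eH.
have neab : (a, b) != (b, a).
  by apply/eqP => -[e1 _]; move: ab; rewrite e1 adj_irr.
have -> : 2%N = ((a, b) != (b, a)).+1 by rewrite neab.
rewrite -cards2 sum1dep_card; apply: eq_card => -[x y].
rewrite !inE /=; apply/andP/orP => [[xyH /eqP xye]|]; last first.
  by move=> [] /eqP[-> ->]; rewrite 1?[[set b; a]]setUC -eab.
have := subsetP sub _ xyH; rewrite set2_edges => xy.
have: x \in e by rewrite -xye set21.
have: y \in e by rewrite -xye set22.
rewrite eab !inE => /orP[]/eqP ey /orP[]/eqP ex; subst x y.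
- by rewrite adj_irr in xy.
- by right.
- by left.
- by rewrite adj_irr in xy.
Qed.

Lemma set0_matching (G : sgraph) : set0 \in matchings G.
Proof. by rewrite inE sub0set; apply/trivIsetP => A; rewrite inE. Qed.

Lemma monomer_set0 (G : sgraph) (v : G) : monomer set0 v.
Proof. by rewrite /monomer /cover big_set0 inE. Qed.

(** The vertex [v] loses [u], and also [x] if [v], [u], [x] form a triangle. Whatever is lost was
    counted before, so the subtractions do not truncate. *)
Lemma monomer_deg_setU1 (G : sgraph) (H : {set {set G}}) (u x v : G) :
    monomer H u -> monomer H x -> adj u x -> adj v u ->
  monomer_deg ([set u; x] |: H) v = (monomer_deg H v - 1 - adj v x)%N.
Proof.
move=> mu mx ux vu.
have neux : x != u by apply: contraTneq ux => ->; rewrite adj_irr.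
rewrite /monomer_deg [in RHS](cardsD1 u) inE vu mu addKn.
rewrite [in RHS](cardsD1 x) !inE neux mx andbT /= addKn.
apply: eq_card => y; rewrite !inE monomer_setU1.
by rewrite andbCA [RHS]andbCA; congr (_ && _); rewrite andbCA.
Qed.

Lemma monomer_deg_le (G : sgraph) (d : nat) (H : {set {set G}}) (v : G) :
  regular G d -> (monomer_deg H v <= d)%N.
Proof.
move=> /(_ v) <-; apply/subset_leq_card/subsetP => u.
by rewrite !inE => /andP[].
Qed.

(** * Weighted sums over monomers and the occupancy fraction *)

(** An expectation multiplied by the partition function, so that the identities below need no
    division. *)
Definition monomer_sum (R : realType) (G : sgraph) (lambda : R) (phi : nat -> R) : R :=
  \sum_(H in matchings G)
    lambda ^+ #|H| * \sum_(v | monomer H v) phi (monomer_deg H v).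

Lemma eq_monomer_sum (R : realType) (G : sgraph) (d : nat) (lambda : R)
    (phi psi : nat -> R) :
    regular G d -> (forall t, (t <= d)%N -> phi t = psi t) ->
  monomer_sum G lambda phi = monomer_sum G lambda psi.
Proof.
move=> G_reg eq_phi; apply: eq_bigr => H _; congr (_ * _).
by apply: eq_bigr => v _; rewrite eq_phi // monomer_deg_le.
Qed.

Lemma monomer_sumB (R : realType) (G : sgraph) (lambda : R) (phi psi : nat -> R) :
  monomer_sum G lambda (fun t => phi t - psi t) =
  monomer_sum G lambda phi - monomer_sum G lambda psi.
Proof.
rewrite /monomer_sum -sumrB; apply: eq_bigr => H _.
by rewrite -mulrBr -sumrB.
Qed.

Lemma monomer_sumZ (R : realType) (G : sgraph) (lambda c : R) (phi : nat -> R) :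
  monomer_sum G lambda (fun t => c * phi t) = c * monomer_sum G lambda phi.
Proof.
rewrite /monomer_sum mulr_sumr; apply: eq_bigr => H _.
by rewrite mulrCA -mulr_sumr.
Qed.

Lemma sum_monomer_nbr (R : realType) (G : sgraph) (H : {set {set G}}) (v : G) (c : R) :
  \sum_(u | adj v u && monomer H u) c = (monomer_deg H v)%:R * c.
Proof. by rewrite sumr_const mulr_natl /monomer_deg cardsE. Qed.

Lemma sum_monomer_nbr_neq (R : realType) (G : sgraph) (H : {set {set G}}) (u v : G)
    (c : R) : adj v u -> monomer H v ->
  \sum_(x | [&& adj u x, monomer H x & x != v]) c = ((monomer_deg H u)%:R - 1) * c.
Proof.
move=> vu mv; rewrite mulrBl -sum_monomer_nbr [in RHS](bigD1 v) /=; last first.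
  by rewrite adj_sym vu.
rewrite mul1r addrC addrK; by apply: eq_bigl => x; rewrite andbA.
Qed.

(** The unnormalized expected number of covered vertices. *)
Definition dimer_sum (R : realType) (G : sgraph) (lambda : R) : R :=
  \sum_(H in matchings G) lambda ^+ #|H| * (2 * #|H|)%:R.

Lemma sum_partner (R : pzSemiRingType) (G : sgraph) (H : {set {set G}}) :
  H \in matchings G ->
  (2 * #|H|)%:R = \sum_(u : G) \sum_(v : G) ([set u; v] \in H)%:R :> R.
Proof.
move=> mH; have sub : H \subset edges G by move: mH; rewrite inE => /andP[].
rewrite -(card_ordered_edges sub) natr_sum; apply: eq_bigr => u _.
by rewrite -sum1dep_card natr_sum big_mkcond; apply: eq_bigr => v _; case: ifP.
Qed.

Lemma monomer_sum1 (R : realType) (G : sgraph) (lambda : R) :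
  monomer_sum G lambda (fun=> 1) =
  #|{: G}|%:R * (matching_poly R G).[lambda] - dimer_sum G lambda.
Proof.
rewrite /matching_poly horner_sum mulr_sumr -sumrB; apply: eq_bigr => H mH.
rewrite hornerXn [#|_|%:R * _]mulrC -mulrBr; congr (_ * _).
have sub : H \subset edges G by move: mH; rewrite inE => /andP[].
rewrite -(card_ordered_edges sub) -sum1_card !natr_sum -sumrB big_mkcond.
apply: eq_bigr => v _; rewrite (card_partner _ mH).
by case: (monomer H v); rewrite ?subr0 ?subrr.
Qed.

(** Removing an oriented edge from a matching leaves an ordered pair of adjacent monomers and costs
    one factor [lambda]. *)
Lemma monomer_sum_deg (R : realType) (G : sgraph) (lambda : R) :
  lambda * monomer_sum G lambda (fun t => t%:R) = dimer_sum G lambda.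
Proof.
transitivity (\sum_(H in matchings G) \sum_(u : G) \sum_(v : G)
    ([set u; v] \in H)%:R * (lambda ^+ #|H| * 1)); last first.
  apply: eq_bigr => H mH; rewrite (sum_partner R mH) !mulr_sumr.
  apply: eq_bigr => u _; rewrite mulr_sumr; apply: eq_bigr => v _.
  by rewrite mulr1 mulrC.
rewrite exchange_big /=.
under [RHS]eq_bigr do rewrite exchange_big /=.
under [RHS]eq_bigr do under eq_bigr do rewrite sum_matchings_edge.
under [RHS]eq_bigr do rewrite exchange_big /=.
rewrite exchange_big mulr_sumr; apply: eq_bigr => H mH.
rewrite mulrCA mulr_sumr mulr_sumr big_mkcond; apply: eq_bigr => u _.
case mu : (monomer H u); last by rewrite big1 // => v _; rewrite mul0r.
rewrite -mulr_suml mulr1 mulrA mulrC; congr (_ * _).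
rewrite /monomer_deg -sum1dep_card natr_sum big_mkcond; apply: eq_bigr => v _ /=.
by rewrite andbC; case: (_ && _).
Qed.

Lemma matching_poly_gt0 (R : realType) (G : sgraph) (lambda : R) :
  0 < lambda -> 0 < (matching_poly R G).[lambda].
Proof.
move=> l0.
rewrite /matching_poly horner_sum (bigD1 set0) ?set0_matching //= ltr_pwDl //.
  by rewrite hornerXn exprn_gt0.
by apply: sumr_ge0 => H _; rewrite hornerXn exprn_ge0 // ltW.
Qed.

(** The handshake identity turns the normalization per edge into one per vertex. *)
Lemma edge_occupancyE (R : realType) (G : sgraph) (d : nat) (lambda : R) :
    regular G d -> (0 < d)%N -> (0 < #|{: G}|)%N -> 0 < lambda ->
  (#|{: G}| * d)%:R * (matching_poly R G).[lambda] * edge_occupancy G lambda =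
  dimer_sum G lambda.
Proof.
move=> G_reg d0 n0 l0.
have E2 : (#|{: G}| * d = 2 * #|edges G|)%N.
  rewrite -(card_ordered_edges (subxx (edges G))) -sum_nat_const.
  apply: eq_bigr => u _; rewrite -(G_reg u); apply: eq_card => v.
  by rewrite !inE set2_edges.
have E0 : #|edges G|%:R != 0 :> R.
  have : (0 < #|{: G}| * d)%N by rewrite muln_gt0 n0.
  by rewrite pnatr_eq0 -lt0n E2 muln_gt0.
have Z0 : (matching_poly R G).[lambda] != 0 by rewrite gt_eqF ?matching_poly_gt0.
have -> : dimer_sum G lambda =
    2 * \sum_(e in edges G) \sum_(H in matchings G | e \in H) lambda ^+ #|H|.
  rewrite (exchange_big_dep (mem (matchings G))) => [|e H _ /andP[]//] /=.
  rewrite mulr_sumr; apply: eq_bigr => H; rewrite inE => /andP[sub triv].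
  rewrite (eq_bigl (mem H)) => [|e].
    by rewrite sumr_const natrM mulrCA mulr_natr.
  rewrite !inE sub triv /=; apply/andP/idP => [[]//|eH].
  by rewrite (subsetP sub).
rewrite /edge_occupancy E2 natrM.
rewrite [X in _^-1 * X](_ : _ = (\sum_(e in edges G)
  \sum_(H in matchings G | e \in H) lambda ^+ #|H|) / (matching_poly R G).[lambda]).
  move: E0 Z0; set E := #|edges G|%:R; set Z := _.[lambda]; set S := \sum_(e in _) _.
  by clearbody E Z S => E0 Z0; field; rewrite E0 Z0.
by rewrite mulr_suml; apply: eq_bigr => e _; rewrite mulr_suml.
Qed.

(** * The defect identity *)

(** Each covered neighbour [u] has exactly one partner [x]. Naming it produces the edge indicator
    that [sum_matchings_edge] can handle. *)
Lemma sum_covered_nbr (R : realType) (G : sgraph) (d : nat) (H : {set {set G}})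
    (v : G) (c : R) :
    regular G d -> H \in matchings G ->
  (d%:R - (monomer_deg H v)%:R) * c =
  \sum_u \sum_x ([set u; x] \in H)%:R * ((adj v u)%:R * c).
Proof.
move=> G_reg mH.
transitivity (\sum_(u | adj v u) (1 - (monomer H u)%:R) * c).
  rewrite -mulr_suml sumrB sumr_const -cardsE G_reg; congr ((_ - _) * _).
  rewrite /monomer_deg -sum1dep_card natr_sum big_mkcondr.
  by apply: eq_bigr => u _; case: (monomer H u).
rewrite big_mkcond; apply: eq_bigr => u _; rewrite -mulr_suml.
have -> : \sum_x ([set u; x] \in H)%:R = 1 - (monomer H u)%:R :> R.
  transitivity (#|[set x | [set u; x] \in H]|%:R : R).
    rewrite -sum1dep_card natr_sum [RHS]big_mkcond.
    by apply: eq_bigr => x _; case: (_ \in H).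
  by rewrite (card_partner _ mH); case: (monomer H u); rewrite ?subrr ?subr0.
by case: (adj v u); rewrite ?mul1r ?mul0r ?mulr0.
Qed.

(* Adding the edge [ux] to a matching turns the configurations with [u], [v],
   [x] uncovered into those with [v] uncovered and its neighbour [u] covered. *)
Lemma monomer_sum_covered (R : realType) (G : sgraph) (d : nat) (lambda : R)
    (f : nat -> R) : regular G d ->
  monomer_sum G lambda (fun t => (d%:R - t%:R) * f t) =
  lambda * \sum_(H in matchings G) lambda ^+ #|H| *
    \sum_(v | monomer H v) \sum_(u | adj v u && monomer H u)
      \sum_(x | [&& adj u x, monomer H x & x != v])
         f (monomer_deg H v - 1 - adj v x)%N.
Proof.
move=> G_reg.
pose F (v u : G) (H : {set {set G}}) : R :=
  (monomer H v)%:R * ((adj v u)%:R * f (monomer_deg H v)).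
transitivity (\sum_(H in matchings G) \sum_(v : G) \sum_(u : G) \sum_(x : G)
    ([set u; x] \in H)%:R * (lambda ^+ #|H| * F v u H)).
  apply: eq_bigr => H mH; rewrite mulr_sumr big_mkcond; apply: eq_bigr => v _.
  rewrite (sum_covered_nbr _ _ G_reg mH) /F.
  case: (monomer H v); last first.
    by rewrite big1 // => u _; rewrite big1 // => x _; rewrite mul0r !mulr0.
  rewrite mulr_sumr; apply: eq_bigr => u _; rewrite mulr_sumr.
  by apply: eq_bigr => x _; rewrite mul1r mulrCA.
transitivity (\sum_(v : G) \sum_(u : G) \sum_(x : G) \sum_(H in matchings G)
    [&& monomer H u, monomer H x & adj u x]%:R *
     (lambda ^+ #|H| * (lambda * F v u ([set u; x] |: H)))).
  rewrite exchange_big; apply: eq_bigr => v _.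
  rewrite exchange_big; apply: eq_bigr => u _.
  rewrite exchange_big; apply: eq_bigr => x _.
  exact: sum_matchings_edge.
transitivity (\sum_(H in matchings G) \sum_(v : G) \sum_(u : G) \sum_(x : G)
    [&& monomer H u, monomer H x & adj u x]%:R *
     (lambda ^+ #|H| * (lambda * F v u ([set u; x] |: H)))).
  rewrite [RHS]exchange_big; apply: eq_bigr => v _.
  rewrite [RHS]exchange_big; apply: eq_bigr => u _.
  by rewrite [RHS]exchange_big.
rewrite mulr_sumr; apply: eq_bigr => H mH.
rewrite mulrCA !mulr_sumr [RHS]big_mkcond; apply: eq_bigr => v _.
have [mv|mv] := boolP (monomer H v); last first.
  rewrite big1 // => u _; rewrite big1 // => x _.
  by rewrite /F monomer_setU1 (negbTE mv) !andbF mul0r !mulr0.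
rewrite !mulr_sumr [RHS]big_mkcond; apply: eq_bigr => u _.
have [/andP[vu mu]|vu] := ifP; last first.
  rewrite big1 // => x _; rewrite /F; move: vu.
  by case: (adj v u) => /= [->|]; rewrite ?mul0r ?mulr0.
rewrite !mulr_sumr [RHS]big_mkcond; apply: eq_bigr => x _.
(* The new edge must leave [v] a monomer; this is the source of [x != v]. *)
rewrite /F monomer_setU1 mu mv vu /=.
have -> : v != u by apply: contraTneq vu => ->; rewrite adj_irr.
rewrite andbT eq_sym andbA [monomer H x && _]andbC.
have [/andP[ux mx]|] := boolP (adj u x && monomer H x); last by rewrite mul0r.
rewrite monomer_deg_setU1 //.
by case: (x != v); rewrite /= ?mul0r ?mulr0 ?mul1r.
Qed.

(** Exchanging [v] and [u] and averaging yields a product of two differences, which has a definite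
    sign once [f] is monotone in [t]. *)
Lemma sum_symmetrize (R : realFieldType) (I : finType) (P : rel I) (Q : pred I)
    (t f : I -> R) : symmetric P ->
  \sum_(v | Q v) \sum_(u | P v u && Q u) (t v - t u) * f v =
  \sum_(v | Q v) \sum_(u | P v u && Q u) 2^-1 * ((t v - t u) * (f v - f u)).
Proof.
move=> symP; set S := LHS.
have S' : S = \sum_(v | Q v) \sum_(u | P v u && Q u) (t u - t v) * f u.
  rewrite /S (exchange_big_dep Q) /= => [|v u _ /andP[]//].
  apply: eq_bigr => u Qu; apply: eq_bigl => v.
  by rewrite symP Qu andbT andbC.
transitivity (2^-1 * (S + S)); first by field.
rewrite {1}S' /S -big_split /= mulr_sumr; apply: eq_bigr => v _.
rewrite -big_split /= mulr_sumr; apply: eq_bigr => u _; ring.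
Qed.

(** The last sum ranges over all monomer neighbours of [u] other than [v], but its terms vanish
    unless [x] is also adjacent to [v]. *)
Definition defect (R : realType) (G : sgraph) (f : nat -> R) (H : {set {set G}})
    (v u : G) : R :=
  2^-1 * (((monomer_deg H v)%:R - (monomer_deg H u)%:R) *
          (f (monomer_deg H v).-1 - f (monomer_deg H u).-1)) +
  \sum_(x | [&& adj u x, monomer H x & x != v])
     (f (monomer_deg H v).-1 - f (monomer_deg H v - 1 - adj v x)%N).

(** Both terms become sums over adjacent monomers [v], [u]. There are [t(u) - 1] choices of [x], so
    the difference is [(t(v) - t(u)) f(t(v) - 1)] plus the triangle terms; the former is then
    symmetrized. *)
Lemma monomer_sum_defect (R : realType) (G : sgraph) (d : nat) (lambda : R)
    (f : nat -> R) : regular G d ->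
  monomer_sum G lambda (fun t => lambda * (t%:R * (t%:R - 1)) * f t.-1
                                 - (d%:R - t%:R) * f t) =
  lambda * \sum_(H in matchings G) lambda ^+ #|H| *
    \sum_(v | monomer H v) \sum_(u | adj v u && monomer H u) defect f H v u.
Proof.
move=> G_reg; rewrite monomer_sumB (monomer_sum_covered _ _ G_reg) !mulr_sumr.
rewrite -sumrB; apply: eq_bigr => H _.
set S3 := \sum_(v | _) _; set D := \sum_(v | _) \sum_(u | _) defect _ _ _ _.
set S2 := \sum_(v | _) _.
have -> : S2 = lambda * \sum_(v | monomer H v) \sum_(u | adj v u && monomer H u)
    ((monomer_deg H v)%:R - 1) * f (monomer_deg H v).-1.
  rewrite mulr_sumr; apply: eq_bigr => v _; rewrite sum_monomer_nbr; ring.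
rewrite mulrCA -mulrBr; congr (lambda * _); rewrite -mulrBr; congr (_ * _).
rewrite /D /defect; under [RHS]eq_bigr do rewrite big_split /=.
rewrite [RHS]big_split /= -(sum_symmetrize (monomer H) (fun v => (monomer_deg H v)%:R)
  (fun v => f (monomer_deg H v).-1)); last exact: adj_sym.
rewrite -big_split -sumrB; apply: eq_bigr => v mv /=.
rewrite -big_split -sumrB; apply: eq_bigr => u /andP[vu mu] /=.
by rewrite sumrB sum_monomer_nbr_neq //; ring.
Qed.

(** * Sign of the defects *)

Lemma defect_eq0 (R : realType) (G : sgraph) (f : nat -> R) (H : {set {set G}})
    (v u : G) :
    monomer_deg H v = monomer_deg H u ->
    (forall x, adj u x -> adj v x -> ~~ monomer H x) ->
  defect f H v u = 0.
Proof.
move=> eq_deg no_tri; rewrite /defect eq_deg subrr mul0r mulr0 add0r.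
apply: big1 => x /and3P[ux mx _]; have [vx|_] := boolP (adj v x).
  by rewrite (negbTE (no_tri x ux vx)) in mx.
by rewrite subn1 subn0 subrr.
Qed.

(** All arguments of [f] lie below [d], where it is strictly increasing. Unequal degrees make the
    first part positive, and each triangle of monomers gives a positive term of the second. *)
Lemma defect_ge0 (R : realType) (G : sgraph) (d : nat) (f : nat -> R)
    (H : {set {set G}}) (v u : G) :
    regular G d -> adj v u -> monomer H v -> monomer H u ->
    (forall s t, (s < t)%N -> (t < d)%N -> f s < f t) ->
  0 <= defect f H v u /\
  (defect f H v u = 0 -> monomer_deg H v = monomer_deg H u /\
     forall x, adj u x -> adj v x -> ~~ monomer H x).
Proof.
move=> G_reg vu mv mu f_incr.
have deg_gt0 (a b : G) : adj a b -> monomer H b -> (0 < monomer_deg H a)%N.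
  by move=> ab mb; rewrite card_gt0; apply/set0Pn; exists b; rewrite inE ab.
have v0 := deg_gt0 _ _ vu mu.
have u0 : (0 < monomer_deg H u)%N by apply: deg_gt0 mv; rewrite adj_sym.
have vd := monomer_deg_le H v G_reg; have ud := monomer_deg_le H u G_reg.
have tri (x : G) : adj u x -> adj v x -> monomer H x ->
    f (monomer_deg H v - 1 - adj v x)%N < f (monomer_deg H v).-1.
  move=> ux vx mx; rewrite vx; apply: f_incr; last by lia.
  (* Both [u] and [x] are monomer neighbours of [v], so the argument of [f] really drops. *)
  suff : (1 < monomer_deg H v)%N by lia.
  rewrite /monomer_deg (cardsD1 u) inE vu mu (cardsD1 x) !inE vx mx.
  by rewrite (contraTneq _ ux) // => ->; rewrite adj_irr.
have B_ge0 (x : G) : [&& adj u x, monomer H x & x != v] ->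
    0 <= f (monomer_deg H v).-1 - f (monomer_deg H v - 1 - adj v x)%N.
  case/and3P=> ux mx _; rewrite subr_ge0.
  have [vx|_] := boolP (adj v x); last by rewrite subn0 subn1.
  by have := tri x ux vx mx; rewrite vx => /ltW.
have A_ge0 : 0 <= 2^-1 * (((monomer_deg H v)%:R - (monomer_deg H u)%:R) *
    (f (monomer_deg H v).-1 - f (monomer_deg H u).-1)) ?= iff
    (monomer_deg H v == monomer_deg H u).
  move: (monomer_deg H v) (monomer_deg H u) v0 u0 vd ud.
  move=> [//|s] [//|t] _ _ sd td /=; rewrite eqSS.
  apply/leifP; have [st|ts|->] := ltngtP s t; last by rewrite subrr mul0r mulr0.
    rewrite mulr_gt0 ?invr_gt0 // nmulr_rgt0 subr_lt0 ?ltr_nat //.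
    exact: f_incr.
  rewrite mulr_gt0 ?invr_gt0 // mulr_gt0 // subr_gt0 ?ltr_nat //.
  exact: f_incr.
split; first by rewrite addr_ge0 ?A_ge0 ?sumr_ge0.
move/eqP; rewrite paddr_eq0 ?A_ge0 ?sumr_ge0 // eq_sym A_ge0.
case/andP=> /eqP eq_deg /eqP B0; split=> // x ux vx; apply/negP => mx.
have xv : x != v by apply: contraTneq vx => ->; rewrite adj_irr.
have /psumr_eq0P/(_ B0 x) := B_ge0; rewrite ux mx xv => /(_ isT)/eqP.
by rewrite gt_eqF // subr_gt0 tri.
Qed.

Lemma monomer_sum_defect_ge0 (R : realType) (G : sgraph) (d : nat) (lambda : R)
    (f : nat -> R) :
    regular G d -> 0 < lambda ->
    (forall s t, (s < t)%N -> (t < d)%N -> f s < f t) ->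
  let D := monomer_sum G lambda
    (fun t => lambda * (t%:R * (t%:R - 1)) * f t.-1 - (d%:R - t%:R) * f t) in
  0 <= D /\
  (D = 0 -> forall (H : {set {set G}}) (v u : G), H \in matchings G -> adj v u ->
     monomer H v -> monomer H u ->
     monomer_deg H v = monomer_deg H u /\
     forall x, adj u x -> adj v x -> ~~ monomer H x).
Proof.
move=> G_reg l0 f_incr D; rewrite {}/D (monomer_sum_defect _ _ G_reg).
have D_ge0 (H : {set {set G}}) (v : G) : monomer H v ->
    0 <= \sum_(u | adj v u && monomer H u) defect f H v u.
  move=> mv; apply: sumr_ge0 => u /andP[vu mu].
  by have [] := defect_ge0 G_reg vu mv mu f_incr.
have W_ge0 (H : {set {set G}}) : H \in matchings G -> 0 <= lambda ^+ #|H| *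
    \sum_(v | monomer H v) \sum_(u | adj v u && monomer H u) defect f H v u.
  by move=> _; rewrite mulr_ge0 ?exprn_ge0 ?(ltW l0) //; apply: sumr_ge0 => v /D_ge0.
split; first by rewrite mulr_ge0 ?(ltW l0) //; apply: sumr_ge0.
move/eqP; rewrite mulrI_eq0; last exact/lregP/lt0r_neq0.
move=> /eqP/(psumr_eq0P W_ge0) eq0 H v u mH vu mv mu.
have /eqP := eq0 H mH; rewrite mulrI_eq0; last first.
  by apply/lregP; rewrite lt0r_neq0 ?exprn_gt0.
move=> /eqP/(psumr_eq0P (D_ge0 H))/(_ v mv)/psumr_eq0P eq0'.
have [_ zero] := defect_ge0 G_reg vu mv mu f_incr.
apply: zero; apply: eq0'; last by rewrite vu.
by move=> x /andP[vx mx]; have [] := defect_ge0 G_reg vx mv mx f_incr.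
Qed.

(** * Positivity and the link with the occupancy gap *)

Lemma monomer_deg_set0 (G : sgraph) (d : nat) (v : G) :
  regular G d -> monomer_deg set0 v = d.
Proof.
by move=> /(_ v) <-; apply: eq_card => u; rewrite !inE monomer_set0 andbT.
Qed.

(** The empty matching alone contributes [phi d] at every vertex. *)
Lemma monomer_sum_gt0 (R : realType) (G : sgraph) (d : nat) (lambda : R)
    (phi : nat -> R) :
    regular G d -> (0 < #|{: G}|)%N -> 0 < lambda ->
    (forall t, 0 <= phi t) -> 0 < phi d ->
  0 < monomer_sum G lambda phi.
Proof.
move=> G_reg /card_gt0P[v _] l0 phi_ge0 phid.
rewrite /monomer_sum (bigD1 set0) ?set0_matching //= cards0 expr0 mul1r.
rewrite ltr_pwDl //.
  rewrite (bigD1 v) ?monomer_set0 //= (monomer_deg_set0 v G_reg) ltr_pwDl //.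
  by apply: sumr_ge0.
apply: sumr_ge0 => H _; rewrite mulr_ge0 ?exprn_ge0 ?(ltW l0) //.
by apply: sumr_ge0.
Qed.

(** Per vertex and after normalization, the right side is the same affine function of the occupancy
    fraction for every [d]-regular graph. A [mu] that annihilates it for [K_{d,d}] therefore makes
    it a multiple of the gap. *)
Lemma monomer_sum_sub_deg (R : realType) (G : sgraph) (d : nat) (lambda mu : R) :
    regular G d -> (0 < d)%N -> (0 < #|{: G}|)%N -> 0 < lambda ->
  monomer_sum G lambda (fun t => mu - t%:R) =
  #|{: G}|%:R * (matching_poly R G).[lambda] *
    (mu - (mu + lambda^-1) * d%:R * edge_occupancy G lambda).
Proof.
move=> G_reg d0 n0 l0.
have degE : monomer_sum G lambda (fun t => t%:R) = lambda^-1 * dimer_sum G lambda.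
  by rewrite -monomer_sum_deg mulKf ?lt0r_neq0.
rewrite monomer_sumB degE.
have -> : monomer_sum G lambda (fun=> mu) = mu * monomer_sum G lambda (fun=> 1).
  by rewrite -monomer_sumZ; apply: eq_bigr => H _; rewrite mulr1.
rewrite monomer_sum1 -(edge_occupancyE G_reg d0 n0 l0) natrM.
move: (_.[_]) (edge_occupancy _ _) #|_|%:R d%:R lambda^-1 => *; ring.
Qed.

(** * The complete bipartite graph *)

Lemma complete_bip_regular (d : nat) : regular (complete_bip d) d.
Proof.
case=> i.
  rewrite -[RHS]card_ord -cardsT -(card_imset _ (@inr_inj 'I_d 'I_d)).
  apply: eq_card => -[j|j]; rewrite !inE /=.
    by apply/esym/imsetP => -[].
  by apply/esym/imsetP; exists j.
rewrite -[RHS]card_ord -cardsT -(card_imset _ (@inl_inj 'I_d 'I_d)).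
apply: eq_card => -[j|j]; rewrite !inE /=; last first.
  by apply/esym/imsetP => -[].
by apply/esym/imsetP; exists j.
Qed.

(** A matching covers equally many vertices on each side ([L] and [R]), and every vertex sees all
    monomers of the opposite side. *)
Lemma complete_bip_monomer_deg (d : nat) (H : {set {set complete_bip d}})
    (v u : complete_bip d) :
  H \in matchings (complete_bip d) -> adj v u -> monomer_deg H v = monomer_deg H u.
Proof.
move=> mH; have sub : H \subset edges (complete_bip d).
  by move: mH; rewrite inE => /andP[].
pose L := (\sum_(i < d) ~~ monomer H (inl i : complete_bip d))%N.
pose R := (\sum_(i < d) ~~ monomer H (inr i : complete_bip d))%N.
have LE : L = (\sum_(i < d) \sum_(j < d)
    ([set (inl i : complete_bip d); inr j] \in H))%N.
  apply: eq_bigr => i _; rewrite -(card_partner _ mH) -sum1dep_card big_mkcond.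
  rewrite big_sumType /= big1 ?add0n => [|j _].
    by apply: eq_bigr => j _; case: (_ \in H).
  by case: ifP => // /(subsetP sub); rewrite set2_edges.
have RE : R = (\sum_(i < d) \sum_(j < d)
    ([set (inr i : complete_bip d); inl j] \in H))%N.
  apply: eq_bigr => i _; rewrite -(card_partner _ mH) -sum1dep_card big_mkcond.
  rewrite big_sumType /= addnC big1 ?add0n => [|j _].
    by apply: eq_bigr => j _; case: (_ \in H).
  by case: ifP => // /(subsetP sub); rewrite set2_edges.
have LR : L = R.
  rewrite LE RE exchange_big; apply: eq_bigr => i _; apply: eq_bigr => j _.
  by rewrite setUC.
have degl i : (monomer_deg H (inl i : complete_bip d) + R = d)%N.
  rewrite /monomer_deg -sum1dep_card big_mkcond big_sumType /= big1 // add0n.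
  rewrite -big_split /= -[RHS]card_ord -sum1_card; apply: eq_bigr => j _.
  by case: (monomer _ _).
have degr i : (monomer_deg H (inr i : complete_bip d) + L = d)%N.
  rewrite /monomer_deg -sum1dep_card big_mkcond big_sumType /=.
  rewrite addnAC addnC big1 // add0n.
  rewrite -big_split /= -[RHS]card_ord -sum1_card; apply: eq_bigr => j _.
  by case: (monomer _ _).
case: v u => [i|i] [j|j] // _; apply/eqP.
  by rewrite -(eqn_add2r R) degl -LR degr.
by rewrite -(eqn_add2r R) degl -LR degr.
Qed.

Lemma complete_bip_monomer_sum (R : realType) (d : nat) (lambda : R) (f : nat -> R) :
  monomer_sum (complete_bip d) lambda
    (fun t => lambda * (t%:R * (t%:R - 1)) * f t.-1 - (d%:R - t%:R) * f t) = 0.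
Proof.
rewrite (monomer_sum_defect _ _ (@complete_bip_regular d)) big1 ?mulr0 // => H mH.
rewrite big1 ?mulr0 // => v mv; rewrite big1 // => u /andP[vu mu].
apply: defect_eq0; first exact: complete_bip_monomer_deg.
by case: v u {mv mu} vu => [i|i] [j|j] // _ [k|k].
Qed.

(** * The equality case *)

Lemma twin_nbr (G : sgraph) (d : nat) : regular G d ->
    (forall (H : {set {set G}}) (v u : G), H \in matchings G -> adj v u ->
     monomer H v -> monomer H u ->
     monomer_deg H v = monomer_deg H u /\
     forall x, adj u x -> adj v x -> ~~ monomer H x) ->
  forall u v w : G, adj u v -> adj u w -> adj w =1 adj v.
Proof.
move=> G_reg defect0.
have no_tri (u v w : G) : adj u v -> adj u w -> adj v w -> False.
  move=> uv uw vw.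
  have [_ /(_ w vw uw)] :=
    defect0 set0 u v (set0_matching G) uv (monomer_set0 u) (monomer_set0 v).
  by rewrite monomer_set0.
have nbrS (u v w x : G) : adj u v -> adj u w -> adj w x -> adj v x.
  move=> uv uw wx.
  have neq (a b : G) : adj a b -> b != a.
    by move=> ab; apply: contraTneq ab => ->; rewrite adj_irr.
  apply/negPn/negP => vxN.
  have neq_vw : v != w by apply: contraNneq vxN => ->.
  have neq_vx : v != x.
    by apply/eqP => vx; apply: (no_tri u v w); rewrite // vx adj_sym.
  have neq_ux : u != x by apply: contraNneq vxN => <-; rewrite adj_sym.
  have neq_uw : u != w by rewrite eq_sym neq.
  (* In the matching with the single edge [wx], [u] loses exactly [w] while [v] keeps all [d]
     neighbours, against the equality of degrees. *)
  have := @add_edge_matching G set0 w x.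
  rewrite set0_matching !monomer_set0 wx => /andP[mH _].
  have mu : monomer ([set w; x] |: set0) u.
    by rewrite monomer_setU1 neq_uw neq_ux monomer_set0.
  have mv : monomer ([set w; x] |: set0) v.
    by rewrite monomer_setU1 neq_vw neq_vx monomer_set0.
  have [] := defect0 _ u v mH uv mu mv.
  rewrite monomer_deg_setU1 ?monomer_set0 // (monomer_deg_set0 u G_reg).
  have -> : adj u x = false.
    by apply/negP => ux; exact: (no_tri u w x).
  have -> : monomer_deg ([set w; x] |: set0) v = d.
    rewrite -(monomer_deg_set0 v G_reg); apply: eq_card => y.
    rewrite !inE monomer_setU1 monomer_set0 !andbT.
    have [vy|//] := boolP (adj v y).
    apply/and3P; split=> //; apply: contraTneq vy => ->; last exact: vxN.
    by apply/negP => adj_vw; exact: (no_tri u v w).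
  have : (0 < d)%N by rewrite -(G_reg u) card_gt0; apply/set0Pn; exists v; rewrite inE.
  by move=> d0 /eqP; lia.
by move=> u v w uv uw x; apply/idP/idP; apply: nbrS; eassumption.
Qed.

(** The component of [r] has the parts [N(r)] and [N(r')] for any neighbour [r'] of [r]; enumerating
    both gives a copy of [K_{d,d}]. *)
Lemma twin_nbr_isomorphic (G : sgraph) (d : nat) : regular G d -> (0 < d)%N ->
    (forall u v w : G, adj u v -> adj u w -> adj w =1 adj v) ->
  exists n, isomorphic G (disjoint_copies n (complete_bip d)).
Proof.
move=> G_reg d0 twin.
have ex_nb (x : G) : exists y, adj x y.
  have : (0 < #|[set y | adj x y]|)%N by rewrite G_reg.
  by case/card_gt0P=> y; rewrite inE; exists y.
pose nb (x : G) := xchoose (ex_nb x).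
have nbP (x : G) : adj x (nb x) := xchooseP (ex_nb x).
have nb_twin (x y : G) : adj (nb x) y -> adj y =1 adj x.
  by apply: twin; rewrite adj_sym.
(* One representative per component; their number is the witness [n]. *)
pose A := [set x : G | fingraph.root (@adj G) x == x].
have csym : connect_sym (@adj G) := sym_connect_sym (@adj_sym G).
(* Both lists have length [d], so the default [r] of [nth] is never reached. *)
pose side (r : G) (s : 'I_d + 'I_d) : G :=
  match s with
  | inl j => nth r (enum [set y | adj (nb r) y]) j
  | inr j => nth r (enum [set y | adj r y]) j
  end.
have size_nbr (x : G) : size (enum [set y | adj x y]) = d by rewrite -cardE G_reg.
have sideL r j : adj (nb r) (side r (inl j)).
  have : side r (inl j) \in enum [set y | adj (nb r) y].
    by rewrite mem_nth // size_nbr.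
  by rewrite mem_enum inE.
have sideR r j : adj r (side r (inr j)).
  have : side r (inr j) \in enum [set y | adj r y] by rewrite mem_nth // size_nbr.
  by rewrite mem_enum inE.
have side_adj r s s' : adj (side r s) (side r s') = bip_adj s s'.
  case: s => j /=.
    have twj := nb_twin _ _ (sideL r j).
    case: s' => k /=; rewrite twj; last exact: sideR.
    by rewrite -(nb_twin _ _ (sideL r k)) adj_irr.
  have twj := twin r (nb r) _ (nbP r) (sideR r j).
  case: s' => k /=; rewrite twj; first exact: sideL.
  by rewrite -(twin r (nb r) _ (nbP r) (sideR r k)) adj_irr.
have side_inj r : injective (side r).
  move=> s s' ess.
  have : bip_adj s s' = false by rewrite -(side_adj r) ess adj_irr.
  case: s s' ess => j [k|k] //= /eqP.
    by rewrite nth_uniq ?size_nbr ?enum_uniq // => /eqP/val_inj->.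
  by rewrite nth_uniq ?size_nbr ?enum_uniq // => /eqP/val_inj->.
have side_root r s : fingraph.root (@adj G) (side r s) = fingraph.root (@adj G) r.
  apply/esym/(fingraph.rootP csym); case: s => j; last exact/connect1/sideR.
  by apply: connect_trans (connect1 (nbP r)) (connect1 (sideL r j)).
have rootA (i : 'I_#|A|) : fingraph.root (@adj G) (enum_val i) = enum_val i.
  by have := enum_valP i; rewrite inE => /eqP.
pose g (p : 'I_#|A| * ('I_d + 'I_d)) := side (enum_val p.1) p.2.
have g_root p : fingraph.root (@adj G) (g p) = enum_val p.1 by rewrite side_root rootA.
have g_adj p q : adj (g p) (g q) = (p.1 == q.1) && bip_adj p.2 q.2.
  have [epq|neq] := eqVneq p.1 q.1; first by rewrite /g epq side_adj.
  apply: contraNF neq => /connect1/(fingraph.rootP csym).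
  by rewrite !g_root => /enum_val_inj ->.
have g_inj : injective g.
  move=> [i s] [j t] e; have := congr1 (fingraph.root (@adj G)) e.
  rewrite !g_root => /enum_val_inj /= eij; subst j.
  by congr (_, _); apply: (side_inj (enum_val i)); exact: e.
have g_surj x : exists p, g p = x.
  pose r := fingraph.root (@adj G) x.
  have rA : r \in A by rewrite inE /r fingraph.root_root.
  (* Adjacency swaps the two neighbourhoods, so their union contains the whole component of [r]. *)
  have closedN : closed (@adj G) [pred z | adj r z || adj (nb r) z].
    apply: intro_closed => // y z yz; rewrite !inE => /orP[ry|ry]; apply/orP.
      by right; rewrite -(twin r (nb r) y (nbP r) ry).
    by left; rewrite -(nb_twin _ _ ry).
  have : x \in [pred z | adj r z || adj (nb r) z].
    rewrite -(closed_connect closedN (x := r)); last first.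
      by rewrite csym connect_root.
    by rewrite inE adj_irr /= adj_sym.
  have ex_side s : side r s = x -> exists p, g p = x.
    by move=> <-; exists (enum_rank_in rA r, s); rewrite /g enum_rankK_in.
  have idx y : adj y x ->
      exists j : 'I_d, nth r (enum [set z | adj y z]) j = x.
    move=> yx; have xy : x \in enum [set z | adj y z] by rewrite mem_enum inE.
    have jd : (index x (enum [set z | adj y z]) < d)%N.
      by rewrite -(size_nbr y) index_mem.
    by exists (Ordinal jd); rewrite nth_index.
  rewrite inE => /orP[/idx[j ej]|/idx[j ej]].
    exact: (ex_side (inr j)).
  exact: (ex_side (inl j)).
have [f fK gK] : bijective g.
  apply: inj_card_bij => //; apply: leq_trans (leq_image_card g predT).
  apply/subset_leq_card/subsetP => x _; have [p <-] := g_surj x.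
  exact: image_f.
exists #|A|, f; first by exists g.
by move=> x y; rewrite -{2}(gK x) -{2}(gK y) g_adj.
Qed.

(** * The test function and the comparison *)

(** Forward recursion works while [d - t] is nonzero; the equation at [t = d] is instead a condition
    on [mu]. *)
Lemma poisson_exists (R : realFieldType) (d : nat) (lambda mu : R) :
  exists h : nat -> R, forall t, (t < d)%N -> (d%:R - t%:R) * h t =
    mu - t%:R + lambda * (t%:R * (t%:R - 1)) * h t.-1.
Proof.
(* The default [0] at [t = 0] is multiplied by a zero coefficient. *)
exists (fix h t := (mu - t%:R + lambda * (t%:R * (t%:R - 1)) *
   (if t is s.+1 then h s else 0)) / (d%:R - t%:R)) => t td.
have dt : d%:R - t%:R != 0 :> R by rewrite subr_eq0 gt_eqF // ltr_nat.
case: t td dt => [|t] td dt; rewrite mulrC divfK //=.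
by rewrite mul0r !mulr0 !mul0r.
Qed.

(** Here [mu] is the average of [t(v)] over monomers in [K_{d,d}]. For [d = 1] it equals [d], whence
    the condition on the strict bound. *)
Lemma complete_bip_mean (R : realType) (d : nat) (lambda : R) :
    (0 < d)%N -> 0 < lambda ->
  exists mu : R, [/\ 0 < mu, (1 < d)%N -> mu < d%:R &
    monomer_sum (complete_bip d) lambda (fun t => mu - t%:R) = 0].
Proof.
move=> d0 l0; have K_reg := @complete_bip_regular d.
have n0 : (0 < #|{: complete_bip d}|)%N by rewrite card_sum card_ord addn_gt0 d0.
set M := monomer_sum (complete_bip d) lambda.
have M_gt0 phi : (forall t, 0 <= phi t) -> 0 < phi d -> 0 < M phi :=
  monomer_sum_gt0 K_reg n0 l0.
have M1 : 0 < M (fun=> 1) by apply: M_gt0.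
have MT : 0 < M (fun t => t%:R) by apply: M_gt0; rewrite ?ltr0n.
have M_sub (c : R) : M (fun t => c - t%:R) = c * M (fun=> 1) - M (fun t => t%:R).
  rewrite [LHS]monomer_sumB -[in RHS]monomer_sumZ; congr (_ - _).
  by apply: eq_bigr => H _; rewrite mulr1.
exists (M (fun t => t%:R) / M (fun=> 1)); split; first exact: divr_gt0.
- move=> d1; rewrite ltr_pdivrMr // -subr_gt0 -M_sub.
  (* For [f = 1] the identity equates the sum of [d - t] with that of [lambda t (t - 1)], which is
     positive by the empty matching. *)
  have := complete_bip_monomer_sum d lambda (fun=> 1).
  rewrite monomer_sumB => /subr0_eq.
  have -> : monomer_sum (complete_bip d) lambda (fun t => (d%:R - t%:R) * 1) =
      M (fun t => d%:R - t%:R).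
    by apply: eq_bigr => H _; under eq_bigr do rewrite mulr1.
  move=> <-; apply: M_gt0 => [t|].
    by rewrite mulr1 mulr_ge0 ?natr_falling2_ge0 ?(ltW l0).
  by rewrite mulr1 !mulr_gt0 // ?subr_gt0 ?ltr1n ?ltr0n.
- by rewrite M_sub divfK ?subrr // gt_eqF.
Qed.

Lemma occupancy_certificate (R : realType) (d : nat) (lambda : R) :
    (0 < d)%N -> 0 < lambda ->
  exists (mu : R) (f : nat -> R),
    [/\ 0 < mu,
        monomer_sum (complete_bip d) lambda (fun t => mu - t%:R) = 0,
        forall s t, (s < t)%N -> (t < d)%N -> f s < f t &
        forall t, (t <= d)%N ->
          lambda * (t%:R * (t%:R - 1)) * f t.-1 - (d%:R - t%:R) * f t = mu - t%:R].
Proof.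
move=> d0 l0; have [mu [mu0 mud K0]] := complete_bip_mean d0 l0.
have [h hE] := poisson_exists d lambda mu.
have K_reg := @complete_bip_regular d.
have n0 : (0 < #|{: complete_bip d}|)%N by rewrite card_sum card_ord addn_gt0 d0.
(* The sign turns the decreasing solution into the increasing test function. *)
pose f t := - h t.
pose E t := lambda * (t%:R * (t%:R - 1)) * f t.-1 - (d%:R - t%:R) * f t - (mu - t%:R).
have E_lt t : (t < d)%N -> E t = 0.
  by move=> td; rewrite /E /f; have := hE t td; lra.
(* The identity for [K_{d,d}] forces the equation at the endpoint [t = d]. *)
have Ed : E d = 0.
  have KE : monomer_sum (complete_bip d) lambda E = 0.
    by rewrite monomer_sumB complete_bip_monomer_sum K0 subr0.
  have KI : 0 < monomer_sum (complete_bip d) lambda (fun t => (t == d)%:R).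
    by apply: (monomer_sum_gt0 K_reg) => //; rewrite eqxx.
  apply/eqP; move/eqP: KE; rewrite (eq_monomer_sum (d := d)
    (psi := fun t => E d * (t == d)%:R) _ K_reg) => [|t].
    by rewrite monomer_sumZ mulf_eq0 (gt_eqF KI) orbF.
  by rewrite leq_eqVlt => /predU1P[->|td];
    [rewrite eqxx mulr1 | rewrite E_lt // ltn_eqF // mulr0].
have EE t : (t <= d)%N -> E t = 0.
  by rewrite leq_eqVlt => /predU1P[->//|/E_lt].
exists mu, f; split=> // [s t st td|t /EE]; last by rewrite /E => /subr0_eq.
(* Two distinct indices below [d] force [d >= 2], the case where [mu < d] is available. *)
have d1 : (1 < d)%N by apply: leq_ltn_trans td; apply: leq_ltn_trans st.
have hE' u : (u <= d)%N -> (d%:R - u%:R) * h u =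
    mu - u%:R + lambda * (u%:R * (u%:R - 1)) * h u.-1.
  by move=> /EE; rewrite /E /f; lra.
have mud' : 0 < mu < d%:R by rewrite mu0 mud.
have decr := poisson_decreasing l0 mud' hE'.
rewrite /f ltrN2; elim: t st td => // t IHt; rewrite ltnS leq_eqVlt.
case/predU1P=> [->|st] td; first exact: decr.
exact: lt_trans (decr t td) (IHt st (ltnW td)).
Qed.

Theorem theorem3 (R : realType) (d : nat) (d_ge1 : (1 <= d)%N)
    (G : sgraph) (G_nonempty : (0 < #|{: G}|)%N) (G_reg : regular G d) :
  (forall lambda : R, 0 < lambda ->
     edge_occupancy G lambda <= edge_occupancy (complete_bip d) lambda) /\
  ((exists2 lambda : R, 0 < lambda &
      edge_occupancy G lambda = edge_occupancy (complete_bip d) lambda) ->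
   exists n : nat, isomorphic G (disjoint_copies n (complete_bip d))).
Proof.
have gap (lambda : R) : 0 < lambda -> exists c (f : nat -> R),
    [/\ 0 < c, forall s t, (s < t)%N -> (t < d)%N -> f s < f t &
      monomer_sum G lambda (fun t => lambda * (t%:R * (t%:R - 1)) * f t.-1
                                     - (d%:R - t%:R) * f t) =
      c * (edge_occupancy (complete_bip d) lambda - edge_occupancy G lambda)].
  move=> l0; have [mu [f [mu0 K0 f_incr fE]]] := occupancy_certificate d_ge1 l0.
  have n0 : (0 < #|{: complete_bip d}|)%N.
    by rewrite card_sum card_ord addn_gt0 d_ge1.
  (* The constant is minus the slope in [monomer_sum_sub_deg]. *)
  exists (#|{: G}|%:R * (matching_poly R G).[lambda] * ((mu + lambda^-1) * d%:R)), f.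
  split=> //.
    rewrite !mulr_gt0 ?matching_poly_gt0 ?ltr0n //.
    by rewrite addr_gt0 ?invr_gt0.
  rewrite (eq_monomer_sum _ G_reg fE) (monomer_sum_sub_deg _ G_reg) //.
  rewrite -[RHS]mulrA [in RHS]mulrBr; congr (_ * (_ - _)); apply/eqP.
  (* By [K0], [mu] is [(mu + lambda^-1) * d] times the occupancy fraction of [K_{d,d}]. *)
  move/eqP: K0; rewrite (monomer_sum_sub_deg _ (@complete_bip_regular d)) //.
  by rewrite !mulf_eq0 pnatr_eq0 eqn0Ngt n0 (gt_eqF (matching_poly_gt0 _ l0)) subr_eq0.
split=> [lambda l0|[lambda l0 eq_occ]].
  have [c [f [c0 f_incr D]]] := gap lambda l0.
  have [] := monomer_sum_defect_ge0 G_reg l0 f_incr.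
  by rewrite D pmulr_rge0 // subr_ge0.
have [c [f [c0 f_incr D]]] := gap lambda l0.
have [_] := monomer_sum_defect_ge0 G_reg l0 f_incr.
rewrite D eq_occ subrr mulr0 => /(_ erefl) defect0.
exact: twin_nbr_isomorphic G_reg d_ge1 (twin_nbr G_reg defect0).
Qed.
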